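(* Consider the HyperLogLog (HLL) sketch with $k$ bins, for which $k_{max}=k$. Let $\epsilon>0$, $\pi_0=1-e^{-\epsilon}$ and $n_0=k/(1-e^{-\epsilon})$. If $n\ge n_0$, then HLL run on streams of cardinality $n$ satisfies $(\epsilon,\delta)$-DP with $\delta\le k\exp(-\pi_0 n/k)$.
   Context: HLL sketch: the state is a vector $(s_1,\dots,s_k)$ of bin values, initially $0$. Using a uniformly random hash function (the internal randomness $r$), each item $x$ is mapped to $(B(x),G(x))$ with $B(x)$ uniform on $\{1,\dots,k\}$ and independently $G(x)\sim\mathrm{Geometric}(1/2)$ on $\{1,2,\dots\}$; inserting $x$ sets $s_{B(x)}\leftarrow\max(s_{B(x)},G(x))$. The probability that a new, previously unseen item changes a state $s$ is $\pi(s)=k^{-1}\sum_{i=1}^k2^{-s_i}$. Write $S_r(\mathcal D)$ for the state on data set $\mathcal D$ and $\mathcal D_{-i}=\mathcal D\setminus\{i\}$. The sketch is $(\epsilon,\delta)$-DP on streams of cardinality $n$ if for every data set $\mathcal D$ of $n$ distinct items, every $i\in\mathcal D$ and every set $A$ of states: $\Pr_r(S_r(\mathcal D)\in A)\le e^{\epsilon}\Pr_r(S_r(\mathcal D_{-i})\in A)+\delta$ and $\Pr_r(S_r(\mathcal D_{-i})\in A)\le e^{\epsilon}\Pr_r(S_r(\mathcal D)\in A)+\delta$. *)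

(* Defs.v *)
From HB Require Import structures.
From mathcomp Require Import all_boot all_order all_algebra.
From mathcomp Require Import finmap.
From mathcomp Require Import all_classical all_reals all_analysis.

Set Implicit Arguments.
Unset Strict Implicit.
Unset Printing Implicit Defensive.

Import Order.TTheory GRing.Theory Num.Theory.

Local Open Scope classical_set_scope.
Local Open Scope ring_scope.

Section DiscreteRandomVariables.
Context d (T : measurableType d) (R : realType) (P : probability T R).

(* All random variables below take values in countable sets carrying the
   discrete sigma-algebra, so that measurability means that every preimage is
   an event. *)
Definition discrete_rv (V : Type) (X : T -> V) : Prop :=
  forall A : set V, measurable (X @^-1` A).

Definition independent2 (V W : Type) (X : T -> V) (Y : T -> W) : Prop :=
  forall (A : set V) (C : set W),
    (P (X @^-1` A `&` Y @^-1` C) = P (X @^-1` A) * P (Y @^-1` C))%E.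

Definition mutually_independent (I : choiceType) (V : Type)
    (X : I -> T -> V) : Prop :=
  forall (J : {fset I}) (A : I -> set V),
    (P (\bigcap_(i in [set` J]) (X i @^-1` A i)) =
     \prod_(i <- J) P (X i @^-1` A i))%E.

End DiscreteRandomVariables.

Section HyperLogLog.
Variables (U : choiceType) (k : nat).

(* A realized hash function sends an item x to (B(x), G(x)). *)
Definition hll_insert (h : U -> 'I_k * nat) (s : {ffun 'I_k -> nat}) (x : U) :
    {ffun 'I_k -> nat} :=
  [ffun b => if b == (h x).1 then maxn (s b) (h x).2 else s b].

Definition hll_init : {ffun 'I_k -> nat} := [ffun=> 0%N].

(* A stream is a sequence of items; a data set {fset U} is processed through
   its enumeration. *)
Definition hll_state (h : U -> 'I_k * nat) (s : seq U) : {ffun 'I_k -> nat} :=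
  foldl (hll_insert h) hll_init s.

Context d (T : measurableType d) (R : realType) (P : probability T R).

(* geometric: the masses on {1, 2, ...} sum to 1, so G(x) = 0 has probability
   zero. *)
Record uniform_hash (H : U -> T -> 'I_k * nat) : Prop := UniformHash {
  uniform_hash_rv : forall x, discrete_rv (H x);
  uniform_hash_bin : forall x (b : 'I_k),
    P [set w | (H x w).1 = b] = (k%:R^-1)%:E;
  uniform_hash_geometric : forall x (g : nat),
    P [set w | (H x w).2 = g.+1] = (2^-1 ^+ g.+1)%:E;
  uniform_hash_coord : forall x,
    independent2 P (fun w => (H x w).1) (fun w => (H x w).2);
  uniform_hash_indep : mutually_independent P H }.

Definition hll_sketch (H : U -> T -> 'I_k * nat) (D : {fset U}) (w : T) :
    {ffun 'I_k -> nat} :=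
  hll_state (fun x => H x w) D.

End HyperLogLog.

Definition sketch_dp (U : choiceType) (St : Type) d (T : measurableType d)
    (R : realType) (P : probability T R) (S : {fset U} -> T -> St)
    (n : nat) (eps delta : R) : Prop :=
  forall D : {fset U}, #|` D| = n -> forall i : U, i \in D ->
  forall A : set St,
    (P (S D @^-1` A) <= (expR eps)%:E * P (S (D `\ i)%fset @^-1` A) + delta%:E)%E
    /\
    (P (S (D `\ i)%fset @^-1` A) <= (expR eps)%:E * P (S D @^-1` A) + delta%:E)%E.

(* Main.v *)
(* Let S and S' be the sketches of D and of D \ {i}.

   S against S': each bin is lowered by the removal of at most one item of D,
   and by exchangeability every item is equally likely to be that one.  Hence,
   inside any event {S in A}, the removal of i changes the state with
   probability at most (k/n) P(S in A), and k/n <= pi0 = 1 - e^-eps.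

   S' against S: given S' = s, the item i falls into bin b without raising it
   with probability (1 - 2^-s_b)/k, which is at least e^-eps/k unless
   2^-s_b > pi0.  Summing over b, the error is governed by the probability that
   bin b, after n - 1 items, has 2^-s_b > pi0 and is still raised by i; a
   geometric bound (1 - pi0/k)^n for it gives delta = k exp(-pi0 n/k). *)
Require Import Defs.
From HB Require Import structures.
From mathcomp Require Import all_boot all_order all_algebra.
From mathcomp Require Import finmap.
From mathcomp Require Import all_classical all_reals all_analysis.
From mathcomp Require Import ring lra zify.

Set Implicit Arguments.
Unset Strict Implicit.
Unset Printing Implicit Defensive.

Import Order.TTheory GRing.Theory Num.Theory.
Local Open Scope classical_set_scope.
Local Open Scope ring_scope.

(** * Real-valued probabilities and countably valued random variables *)

(** Slicing by the code [choice.pickle] writes any subset of a countable type as a sequence of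
    disjoint pieces with at most one point each, the shape that countable additivity requires. *)
Definition code_fiber (V : countType) (A : set V) (n : nat) : set V :=
  [set v : V | A v /\ choice.pickle v = n].

Lemma code_fiberP (V : countType) (A : set V) (n : nat) :
  code_fiber A n = set0 \/ exists2 v, A v & code_fiber A n = [set v].
Proof.
have [[v [Av vn]]|nov] := pselect (exists v, A v /\ choice.pickle v = n).
  right; exists v => //; apply/seteqP; split=> [u [_ un]|_ ->//].
  by apply: (pcan_inj choice.pickleK); rewrite vn un.
by left; apply/seteqP; split=> // v Av; apply: nov; exists v.
Qed.

Section RealProbability.
Context d (T : measurableType d) (R : realType) (P : probability T R).
Implicit Types A B C Q : set T.

(** Real values make subtraction and linear arithmetic available; on events they carry the same
    information as [P], which is finite. *)
Definition pr A : R := fine (P A).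

Lemma prE A : measurable A -> P A = (pr A)%:E.
Proof. by move=> mA; rewrite /pr fineK// fin_num_measure. Qed.

Lemma pr_ge0 A : 0 <= pr A.
Proof. exact: fine_ge0. Qed.

Lemma le_pr A B : measurable A -> measurable B -> A `<=` B -> pr A <= pr B.
Proof. by move=> mA mB AB; rewrite -lee_fin -!prE// le_measure ?inE. Qed.

Lemma prC A : measurable A -> pr (~` A) = 1 - pr A.
Proof.
move=> mA; apply: EFin_inj; rewrite -prE ?probability_setC ?prE//.
exact: measurableC.
Qed.

Lemma pr_splitC A B : measurable A -> measurable B ->
  pr A = pr (A `&` B) + pr (A `&` ~` B).
Proof.
move=> mA mB; have mBC := measurableC mB; apply: EFin_inj.
rewrite EFinD -!prE//; try exact: measurableI.
by rewrite (measureDI P mA mB) setDE addeC.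
Qed.

Lemma pr_bigcup_seq (I : eqType) (s : seq I) (F : I -> set T) A :
  (forall i, measurable (F i)) -> measurable A ->
  A `<=` \bigcup_(i in [set` s]) F i -> pr A <= \sum_(i <- s) pr (F i).
Proof.
move=> mF; elim: s A => [|i s IHs] A mA AF.
  have -> : A = set0 by apply/seteqP; split=> // w /AF [].
  by rewrite big_nil /pr measure0.
rewrite big_cons (pr_splitC mA (mF i)) lerD//.
  by apply: le_pr => //; exact: measurableI.
apply: IHs; first by apply: measurableI => //; exact: measurableC.
move=> w [/AF [j /=]]; rewrite in_cons => /predU1P[->//|js Fj _].
by exists j.
Qed.

(** Induction with [A] generalized: once [F i] is split off, disjointness keeps the remaining sets
    inside [A] minus [F i]. *)
Lemma pr_disjoint_seq (I : eqType) (s : seq I) (F : I -> set T) A :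
  uniq s -> (forall i, measurable (F i)) -> measurable A ->
  (forall i, i \in s -> F i `<=` A) ->
  (forall i j w, i \in s -> j \in s -> F i w -> F j w -> i = j) ->
  \sum_(i <- s) pr (F i) <= pr A.
Proof.
move=> us mF; elim: s us A => [|i s IHs] /= us A mA FA disj.
  by rewrite big_nil pr_ge0.
case/andP: us => nis us; rewrite big_cons (pr_splitC mA (mF i)) lerD//.
  apply: le_pr => //; first exact: measurableI.
  by move=> w Fi; split=> //; apply: FA Fi; rewrite mem_head.
apply: IHs => //.
- by apply: measurableI => //; exact: measurableC.
- move=> j js w Fj; split; first by apply: FA Fj; rewrite in_cons js orbT.
  move=> Fi; suff ij : i = j by rewrite ij js in nis.
  by apply: (disj _ _ w); rewrite ?mem_head// in_cons js orbT.
- by move=> j l w js ls; apply: disj; rewrite in_cons ?js ?ls orbT.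
Qed.

Lemma discrete_rv_comp (V W : Type) (X : T -> V) (f : V -> W) :
  discrete_rv X -> discrete_rv (fun w => f (X w)).
Proof. by move=> dX A; exact: dX (f @^-1` A). Qed.

Lemma discrete_rv_countable (V : countType) (X : T -> V) :
  (forall v, measurable (X @^-1` [set v])) -> discrete_rv X.
Proof.
move=> mX A.
have -> : X @^-1` A = \bigcup_n (X @^-1` code_fiber A n).
  apply/seteqP; split=> [w Aw|w [n _ [Av _]]//].
  by exists (choice.pickle (X w)).
apply: bigcup_measurable => n _.
by have [->|[v _ ->]] := code_fiberP A n; rewrite ?preimage_set0.
Qed.

Lemma discrete_rv_pair (V W : countType) (X : T -> V) (Y : T -> W) :
  discrete_rv X -> discrete_rv Y -> discrete_rv (fun w => (X w, Y w)).
Proof.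
move=> dX dY; apply: discrete_rv_countable => -[v u].
have -> : (fun w => (X w, Y w)) @^-1` [set (v, u)] =
    X @^-1` [set v] `&` Y @^-1` [set u].
  by apply/seteqP; split=> w /=; [case=> -> ->|case=> -> ->].
exact: measurableI.
Qed.

(* Countable additivity extends a comparison of two laws from atoms to all
   events. *)
Lemma le_pr_countable (V : countType) (X Y : T -> V) (Q1 Q2 : set T)
    (A : set V) (c : R) :
  0 <= c -> discrete_rv X -> discrete_rv Y -> measurable Q1 -> measurable Q2 ->
  (forall v, A v -> c * pr (X @^-1` [set v] `&` Q1) <=
                    pr (Y @^-1` [set v] `&` Q2)) ->
  c * pr (X @^-1` A `&` Q1) <= pr (Y @^-1` A `&` Q2).
Proof.
move=> c0 dX dY mQ1 mQ2 leXY.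
pose F (Z : T -> V) (Q : set T) n := Z @^-1` code_fiber A n `&` Q.
have FE Z Q : Z @^-1` A `&` Q = \bigcup_n F Z Q n.
  apply/seteqP; split=> [w [Aw Qw]|w [n _ [[Av _] Qw]]//].
  by exists (choice.pickle (Z w)).
have mF Z Q : discrete_rv Z -> measurable Q -> forall n, measurable (F Z Q n).
  by move=> dZ mQ n; apply: measurableI => //; exact: dZ.
have tF Z Q : trivIset setT (F Z Q).
  by move=> n m _ _ [w [[[_ <-] _] [[_ <-] _]]].
have PF Z Q : discrete_rv Z -> measurable Q ->
    P (Z @^-1` A `&` Q) = (\sum_(n <oo) P (F Z Q n))%E.
  move=> dZ mQ; rewrite FE measure_semi_bigcup//; first exact: mF.
  by apply: bigcup_measurable => n _; exact: mF.
rewrite -lee_fin EFinM -!prE; try by apply: measurableI.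
rewrite !PF// -nneseriesZl//; apply: lee_nneseries => n _.
  by move=> _; apply: mule_ge0.
rewrite !prE; try exact: mF; rewrite -EFinM lee_fin.
rewrite /F; have [->|[v Av ->]] := code_fiberP A n; last exact: leXY.
by rewrite !preimage_set0 !set0I /pr !measure0 mulr0.
Qed.

End RealProbability.

(** * Bins as maxima over the list of hash values *)

Section BinValues.
Variable k : nat.
Implicit Types (v : seq ('I_k * nat)) (b : 'I_k).

(** An empty bin gets the empty maximum 0, in agreement with the initial state. *)
Definition bin_value b v : nat := \max_(y <- v | y.1 == b) y.2.

Lemma bin_value_nil b : bin_value b [::] = 0%N.
Proof. by rewrite /bin_value big_nil. Qed.

Lemma bin_value_cons b y v :
  bin_value b (y :: v) =
  if y.1 == b then maxn y.2 (bin_value b v) else bin_value b v.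
Proof. by rewrite /bin_value big_cons. Qed.

(** A bound on a maximum is one condition per item, the form to which independence of the items
    applies. *)
Lemma bin_value_le b v g :
  (bin_value b v <= g)%N = all (fun y => (y.1 != b) || (y.2 <= g)%N) v.
Proof.
elim: v => [|y v IHv]; first by rewrite bin_value_nil.
by rewrite bin_value_cons /= -IHv; case: eqP => _ //=; rewrite geq_max.
Qed.

Lemma hll_stateE (U : choiceType) (h : U -> 'I_k * nat) (s : seq U) b :
  hll_state h s b = bin_value b [seq h x | x <- s].
Proof.
rewrite /bin_value big_map /hll_state.
(* The maximum with the initial value 0 is made explicit so that the induction can run over an
   arbitrary starting state of the fold. *)
have -> : \max_(x <- s | (h x).1 == b) (h x).2 =
    maxn (hll_init k b) (\max_(x <- s | (h x).1 == b) (h x).2).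
  by rewrite ffunE max0n.
elim: s (hll_init k) => [|x s IHs] t /=; first by rewrite big_nil maxn0.
rewrite IHs ffunE big_cons eq_sym.
by case: eqP => // _; rewrite maxnA.
Qed.

Definition state_of v : {ffun 'I_k -> nat} := [ffun b => bin_value b v].

Lemma hll_state_map (U : choiceType) (h : U -> 'I_k * nat) (s : seq U) :
  hll_state h s = state_of [seq h x | x <- s].
Proof. by apply/ffunP => b; rewrite hll_stateE ffunE. Qed.

Lemma bin_value_ge y v : y \in v -> (y.2 <= bin_value y.1 v)%N.
Proof.
have /allP vP : all (fun z => (z.1 != y.1) || (z.2 <= bin_value y.1 v)%N) v.
  by rewrite -bin_value_le.
by move/vP; rewrite eqxx.
Qed.

Lemma bin_value_perm b v1 v2 : perm_eq v1 v2 -> bin_value b v1 = bin_value b v2.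
Proof. exact: perm_big. Qed.

Lemma state_of_cons_id y v :
  (state_of (y :: v) == state_of v) = (y.2 <= bin_value y.1 v)%N.
Proof.
apply/eqP/idP => [/ffunP/(_ y.1)|yv].
  by rewrite !ffunE bin_value_cons eqxx => /maxn_idPr.
apply/ffunP => b; rewrite !ffunE bin_value_cons; case: eqP => // <-.
exact/maxn_idPr.
Qed.

End BinValues.

(** * The joint law of the hash values *)

Section HashLaw.
Variables (U : choiceType) (k : nat).
Context d (T : measurableType d) (R : realType) (P : probability T R).
Variables (H : U -> T -> 'I_k * nat).
Hypothesis hH : uniform_hash P H.
Implicit Types (s : seq U) (v : seq ('I_k * nat)).

Let dH x : discrete_rv (H x). Proof. exact: uniform_hash_rv hH x. Qed.

(** The sketch is a function of this list, which takes countably many values; all events below are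
    expressed through it. *)
Definition hashes s (w : T) := [seq H x w | x <- s].

Lemma discrete_rv_hashes s : discrete_rv (hashes s).
Proof.
elim: s => [|x s IHs].
  by move=> A; rewrite preimage_cst; case: ifP.
exact: (discrete_rv_comp (fun p => p.1 :: p.2) (discrete_rv_pair (@dH x) IHs)).
Qed.

Lemma pr_hash_indep s (A : U -> set ('I_k * nat)) : uniq s ->
  pr P [set w | forall x, x \in s -> A x (H x w)] =
  \prod_(x <- s) pr P (H x @^-1` A x).
Proof.
move=> us; have sE : perm_eq [fset x in s]%fset s.
  by apply: uniq_perm => // x; rewrite inE.
have := uniform_hash_indep hH [fset x in s]%fset A.
have -> : \bigcap_(i in [set` [fset x in s]%fset]) (H i @^-1` A i) =
   [set w | forall x, x \in s -> A x (H x w)].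
  apply/seteqP; split=> w /= Aw x; first by move=> xs; apply: Aw; rewrite /= inE.
  by rewrite /= inE; exact: Aw.
rewrite (perm_big _ sE) /= /pr => ->.
by under eq_bigr => x _ do rewrite (prE P (@dH x (A x))); rewrite prodEFin.
Qed.

(** Fixing the whole list is a conjunction of one condition per item of [s], so mutual independence
    over [x :: s] separates the factor of [x]. *)
Lemma pr_hashes_head x s v (C : set ('I_k * nat)) : uniq (x :: s) ->
  pr P (hashes s @^-1` [set v] `&` H x @^-1` C) =
  pr P (hashes s @^-1` [set v]) * pr P (H x @^-1` C).
Proof.
move=> /[dup] uxs /= /andP[xs us].
have [sv|sv] := eqVneq (size s) (size v); last first.
  have -> : hashes s @^-1` [set v] = set0.
    by apply/seteqP; split=> // w /= Hv; rewrite -Hv size_map eqxx in sv.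
  by rewrite set0I /pr measure0 mul0r.
(* The item [z] of [s] must take the entry of [v] at its own position; as the sizes agree, the
   default of [nth] is never reached. *)
pose A z : set ('I_k * nat) :=
  if z == x then C else [set y | y = nth y v (index z s)].
have vE w : hashes s w = v <-> forall z, z \in s -> A z (H z w).
  have zx z : z \in s -> (z == x) = false.
    by move=> zs; apply: contraNF xs => /eqP <-.
  split=> [Hv z zs|Aw].
    by rewrite /A zx//= -Hv (nth_map z) ?index_mem// nth_index.
  apply: (@eq_from_nth _ (H x w)); rewrite size_map// => j js.
  rewrite (nth_map x)//; have := Aw (nth x s j) (mem_nth x js).
  rewrite /A zx ?mem_nth//= index_uniq// => {1}->.
  by apply: set_nth_default; rewrite -sv.
have -> : hashes s @^-1` [set v] `&` H x @^-1` C =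
    [set w | forall z, z \in x :: s -> A z (H z w)].
  apply/seteqP; split=> w /=.
    move=> [/vE Aw Cw] z; rewrite in_cons => /predU1P[->|/Aw//].
    by rewrite /A eqxx.
  move=> Aw; split; first by apply/vE => z zs; apply: Aw; rewrite in_cons zs orbT.
  by have := Aw x (mem_head x s); rewrite /A eqxx.
have -> : hashes s @^-1` [set v] = [set w | forall z, z \in s -> A z (H z w)].
  by apply/seteqP; split=> w /vE.
by rewrite !pr_hash_indep// big_cons mulrC {2}/A eqxx.
Qed.

Lemma pr_bin_level x b (C : set nat) :
  pr P (H x @^-1` [set y | y.1 = b /\ C y.2]) =
  k%:R^-1 * pr P [set w | C (H x w).2].
Proof.
apply: EFin_inj; rewrite EFinM -!prE; last 2 first.
- exact: dH [set y | C y.2].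
- exact: dH.
rewrite -(uniform_hash_bin hH x b).
exact: uniform_hash_coord hH x [set b] C.
Qed.

Lemma pr_bin x b : pr P (H x @^-1` [set y | y.1 = b]) = k%:R^-1.
Proof.
apply: EFin_inj; rewrite -prE; last exact: dH.
exact: uniform_hash_bin hH x b.
Qed.

Lemma pr_level_succ x g : pr P [set w | (H x w).2 = g.+1] = 2^-1 ^+ g.+1.
Proof. by rewrite /pr (uniform_hash_geometric hH). Qed.

(** A finite geometric sum. Level 0 is kept apart because the masses are prescribed at positive
    levels only. *)
Lemma pr_level_pos_le x g :
  pr P [set w | (0 < (H x w).2 <= g)%N] = 1 - 2^-1 ^+ g.
Proof.
elim: g => [|g IHg].
  rewrite expr0 subrr.
  suff -> : [set w | (0 < (H x w).2 <= 0)%N] = set0 by rewrite /pr measure0.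
  by apply/seteqP; split=> // w /=; case: (H x w).2.
rewrite (@pr_splitC _ _ _ _ _ [set w | (H x w).2 = g.+1]); last 2 first.
- exact: dH [set y | (0 < y.2 <= g.+1)%N].
- exact: dH [set y | y.2 = g.+1].
have -> : [set w | (0 < (H x w).2 <= g.+1)%N] `&` [set w | (H x w).2 = g.+1] =
    [set w | (H x w).2 = g.+1].
  by apply/seteqP; split=> [w []//|w /= Hw]; split=> //=; rewrite Hw ltnSn.
have -> : [set w | (0 < (H x w).2 <= g.+1)%N] `&`
    ~` [set w | (H x w).2 = g.+1] = [set w | (0 < (H x w).2 <= g)%N].
  by apply/seteqP; split=> w /=; lia.
by rewrite pr_level_succ IHg exprS; lra.
Qed.

(** Level 0 lies outside the levels 1 to g, whose complement has mass 2^-g, for every g. *)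
Lemma pr_level_0 x : pr P [set w | (H x w).2 = 0%N] = 0.
Proof.
apply/eqP; rewrite eq_le pr_ge0 andbT.
have le2 g : pr P [set w | (H x w).2 = 0%N] <= 2^-1 ^+ g :> R.
  rewrite -[leRHS](subKr 1) -(pr_level_pos_le x) -prC; last first.
    exact: dH [set y | (0 < y.2 <= g)%N].
  apply: le_pr; [exact: dH [set y | y.2 = 0%N]| |by move=> w /= ->].
  by apply: measurableC; exact: dH [set y | (0 < y.2 <= g)%N].
rewrite leNgt; apply/negP => p0.
pose p := pr P [set w | (H x w).2 = 0%N]; rewrite -/p in p0 le2.
(* The Archimedean property gives g with 1/p < 2^g, against p <= 2^-g. *)
have := @upper_nthrootP R p^-1 _ (leqnn _).
set g := Num.bound _; apply/negP; rewrite -leNgt.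
by rewrite -(invrK (2 ^+ g)) lef_pV2 ?posrE ?invr_gt0 ?exprn_gt0// -exprVn.
Qed.

Lemma pr_level_le x g : pr P [set w | ((H x w).2 <= g)%N] = 1 - 2^-1 ^+ g.
Proof.
rewrite (@pr_splitC _ _ _ _ _ [set w | (H x w).2 = 0%N]); last 2 first.
- exact: dH [set y | (y.2 <= g)%N].
- exact: dH [set y | y.2 = 0%N].
have -> : [set w | ((H x w).2 <= g)%N] `&` [set w | (H x w).2 = 0%N] =
    [set w | (H x w).2 = 0%N].
  by apply/seteqP; split=> [w []//|w /= Hw]; split=> //=; rewrite Hw.
have -> : [set w | ((H x w).2 <= g)%N] `&` ~` [set w | (H x w).2 = 0%N] =
    [set w | (0 < (H x w).2 <= g)%N].
  by apply/seteqP; split=> w /=; lia.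
by rewrite pr_level_0 pr_level_pos_le add0r.
Qed.

Lemma pr_level_gt x g : pr P [set w | (g < (H x w).2)%N] = 2^-1 ^+ g.
Proof.
have -> : [set w | (g < (H x w).2)%N] = ~` [set w | ((H x w).2 <= g)%N].
  by apply/seteqP; split=> w /=; lia.
rewrite prC; last exact: dH [set y | (y.2 <= g)%N].
by rewrite pr_level_le subKr.
Qed.

(** The complement is a hit of bin [b] at a level above [g], and bin and level are independent. *)
Lemma pr_bin_keeps x b g :
  pr P [set w | ((H x w).1 != b) || ((H x w).2 <= g)%N] =
  1 - k%:R^-1 * 2^-1 ^+ g.
Proof.
rewrite -(pr_level_gt x) -(pr_bin_level x b [set l | (g < l)%N]) -prC; last first.
  exact: dH.
congr (pr P _); apply/seteqP; split=> w /=.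
  by move=> nH [Hb gH]; move: nH; rewrite Hb eqxx/= leqNgt gH.
by move=> nH; rewrite leqNgt -negb_and; apply/andP => -[/eqP ? ?]; exact: nH.
Qed.

(** Each item of [s] independently has to keep bin [b] at most [g], while [C] constrains only the
    fresh item [x]. *)
Lemma pr_bin_value_le x s b g (C : set ('I_k * nat)) : uniq (x :: s) ->
  pr P [set w | (bin_value b (hashes s w) <= g)%N /\ C (H x w)] =
  (1 - k%:R^-1 * 2^-1 ^+ g) ^+ size s * pr P (H x @^-1` C).
Proof.
move=> /[dup] uxs /= /andP[xs us].
pose keeps : set ('I_k * nat) := [set y | (y.1 != b) || (y.2 <= g)%N].
pose A z := if z == x then C else keeps.
have -> : [set w | (bin_value b (hashes s w) <= g)%N /\ C (H x w)] =
    [set w | forall z, z \in x :: s -> A z (H z w)].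
  apply/seteqP; split=> w /=; rewrite bin_value_le all_map.
    move=> [/allP sg Cx] z; rewrite in_cons /A.
    by case: eqP => [-> //|_ /= zs]; exact: sg.
  move=> Aw; split; last by have := Aw x (mem_head x s); rewrite /A eqxx.
  apply/allP => z zs /=; have := Aw z; rewrite in_cons zs orbT => /(_ isT).
  by rewrite /A; case: eqP => // zx; rewrite zx (negbTE xs) in zs.
rewrite pr_hash_indep// big_cons {1}/A eqxx mulrC; congr (_ * _).
rewrite (eq_big_seq (fun=> 1 - k%:R^-1 * 2^-1 ^+ g)) => [|z zs].
  by rewrite big_const_seq count_predT iter_mulr_1.
rewrite /A; case: eqP => [zx|_]; first by rewrite zx (negbTE xs) in zs.
exact: pr_bin_keeps.
Qed.

Lemma pr_hash_atom x x' (y : 'I_k * nat) :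
  pr P (H x @^-1` [set y]) = pr P (H x' @^-1` [set y]).
Proof.
suff E z : H z @^-1` [set y] = H z @^-1` [set u | u.1 = y.1 /\ [set y.2] u.2].
  rewrite !E !pr_bin_level; case: y.2 => [|g]; first by rewrite !pr_level_0.
  by rewrite !pr_level_succ.
by apply/seteqP; split=> w /=; case: (H z w) => [b g]; case: (y) => ? ? /= [-> ->].
Qed.

Lemma pr_hashes_atom s s' v : uniq s -> uniq s' -> size s = size s' ->
  pr P (hashes s @^-1` [set v]) = pr P (hashes s' @^-1` [set v]).
Proof.
elim: s s' v => [|x s IHs] [|x' s'] v //= uxs uxs' [ss'].
case: v => [|y v].
  have E z t : hashes (z :: t) @^-1` [set [::]] = set0.
    by apply/seteqP; split.
  by rewrite !E.
have E z t : hashes (z :: t) @^-1` [set y :: v] =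
    hashes t @^-1` [set v] `&` H z @^-1` [set y].
  by apply/seteqP; split=> w /=; [move=> [-> ->]|move=> [-> ->]].
rewrite !E !pr_hashes_head// (pr_hash_atom x x').
by case/andP: uxs => _ us; case/andP: uxs' => _ us'; rewrite (IHs s').
Qed.

(** Exchangeability: the items are independent and identically distributed, so only the length of a
    duplicate-free stream matters. *)
Lemma pr_hashes_law s s' (E : set (seq ('I_k * nat))) :
  uniq s -> uniq s' -> size s = size s' ->
  pr P (hashes s @^-1` E) = pr P (hashes s' @^-1` E).
Proof.
suff le t t' : uniq t -> uniq t' -> size t = size t' ->
    pr P (hashes t @^-1` E) <= pr P (hashes t' @^-1` E).
  by move=> us us' ss'; apply/eqP; rewrite eq_le !le.
move=> ut ut' tt'; rewrite -[leLHS]mul1r -(setIT (hashes t @^-1` E)).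
rewrite -(setIT (hashes t' @^-1` E)).
apply: le_pr_countable => //; try exact: discrete_rv_hashes.
by move=> v _; rewrite !setIT mul1r (pr_hashes_atom v ut ut').
Qed.

End HashLaw.

(** * Comparing the sketches with and without one item *)

Section Privacy.
Variables (U : choiceType) (k : nat).
Context d (T : measurableType d) (R : realType) (P : probability T R).
Variables (H : U -> T -> 'I_k * nat).
Hypothesis hH : uniform_hash P H.
Implicit Types (s t : seq U) (v : seq ('I_k * nat)).

Local Notation hashes := (hashes H).

Let dH x : discrete_rv (H x). Proof. exact: uniform_hash_rv hH x. Qed.
Let dhashes s (C : set (seq ('I_k * nat))) : measurable [set w | C (hashes s w)].
Proof. exact: (discrete_rv_hashes hH). Qed.

Let dhashes2 s t (C : set (seq ('I_k * nat) * seq ('I_k * nat))) :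
  measurable [set w | C (hashes s w, hashes t w)].
Proof.
exact: discrete_rv_pair (discrete_rv_hashes hH s) (discrete_rv_hashes hH t) _.
Qed.

Let dHhashes x s (C : set (('I_k * nat) * seq ('I_k * nat))) :
  measurable [set w | C (H x w, hashes s w)].
Proof. exact: discrete_rv_pair (@dH x) (discrete_rv_hashes hH s) _. Qed.

(* At most one item of [t] realizes the value of bin [b] in such a way that
   its removal lowers it, and by exchangeability each item is equally likely
   to be that one. *)
Lemma pr_removal_changes_bin x s b (A : set {ffun 'I_k -> nat}) :
  uniq (x :: s) ->
  (size s).+1%:R * pr P [set w | A (state_of (hashes (x :: s) w)) /\
      bin_value b (hashes (x :: s) w) <> bin_value b (hashes s w)] <=
  pr P [set w | A (state_of (hashes (x :: s) w))].
Proof.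
set t := x :: s => ut.
pose F z := [set w | A (state_of (hashes t w)) /\
  bin_value b (hashes t w) <> bin_value b (hashes (rem z t) w)].
have permE z w : z \in t -> perm_eq (hashes t w) (hashes (z :: rem z t) w).
  by move=> zt; apply: (perm_map _ (perm_to_rem zt)).
have FE z : z \in t -> pr P (F z) = pr P (F x).
  (* With the removed item moved to the front, its removal becomes [behead]; the same [E] then
     serves every item, and exchangeability applies. *)
  move=> zt; pose E v := A (state_of v) /\ bin_value b v <> bin_value b (behead v).
  have FzE y : y \in t -> F y = hashes (y :: rem y t) @^-1` E.
    move=> yt; have stE w : state_of (hashes t w) = state_of (hashes (y :: rem y t) w).
      by apply/ffunP => c; rewrite !ffunE (bin_value_perm _ (permE y w yt)).
    by apply/seteqP; split=> w; rewrite /F /E /= stE (bin_value_perm b (permE y w yt)).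
  have uE y : y \in t -> uniq (y :: rem y t).
    by move=> yt; rewrite -(perm_uniq (perm_to_rem yt)).
  rewrite FzE// FzE ?mem_head//; apply: (pr_hashes_law hH); rewrite ?uE ?mem_head//.
  by rewrite -(perm_size (perm_to_rem zt)) -(perm_size (perm_to_rem (mem_head x s))).
have -> : (size s).+1%:R * pr P [set w | A (state_of (hashes t w)) /\
      bin_value b (hashes t w) <> bin_value b (hashes s w)] =
    \sum_(z <- t) pr P (F z).
  rewrite (eq_big_seq (fun=> pr P (F x))); last exact: FE.
  rewrite big_const_seq count_predT iter_addr_0 mulr_natl /F /t /=.
  by rewrite eqxx.
apply: pr_disjoint_seq => //.
- move=> z; exact: (@dhashes2 t (rem z t)
    [set p | A (state_of p.1) /\ bin_value b p.1 <> bin_value b p.2]).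
- exact: (@dhashes t [set v | A (state_of v)]).
- by move=> z zt w [].
(* If removing [y] lowers bin [b], then [y] alone attains the maximum there; it survives the removal
   of [z], which therefore cannot lower the bin. *)
move=> y z w yt zt [_ Fy] [_ Fz]; apply/eqP/negPn/negP => yz; apply: Fz.
have le_rem : (bin_value b (hashes (rem z t) w) <= bin_value b (hashes t w))%N.
  rewrite [leqRHS](bin_value_perm b (permE z w zt)) bin_value_cons.
  by case: ifP => // _; exact: leq_maxr.
have y_rem : H y w \in hashes (rem z t) w.
  by apply: map_f; rewrite mem_rem_uniq// inE yt yz.
apply/eqP; rewrite eqn_leq le_rem andbT.
move: Fy; rewrite (bin_value_perm b (permE y w yt)) bin_value_cons.
case: eqP => // <-; rewrite /maxn; case: ltnP => // _ _.
exact: bin_value_ge.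
Qed.

(** A union bound over the k bins makes a change of state cost at most a fraction k/n of the event,
    n counting [x]; without a change both states lie in [A] together. *)
Lemma pr_insert_le x s (A : set {ffun 'I_k -> nat}) : uniq (x :: s) ->
  (1 - k%:R / (size s).+1%:R) * pr P [set w | A (state_of (hashes (x :: s) w))] <=
  pr P [set w | A (state_of (hashes s w))].
Proof.
move=> uxs; set F := [set w | A (state_of (hashes (x :: s) w))].
pose C b := [set w | A (state_of (hashes (x :: s) w)) /\
  bin_value b (hashes (x :: s) w) <> bin_value b (hashes s w)].
pose J := [set w | state_of (hashes (x :: s) w) <> state_of (hashes s w)].
have mF : measurable F by exact: (@dhashes (x :: s) [set v | A (state_of v)]).
have mJ : measurable J.
  exact: (@dhashes2 (x :: s) s [set p | state_of p.1 <> state_of p.2]).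
have mC b : measurable (C b).
  exact: (@dhashes2 (x :: s) s
    [set p | A (state_of p.1) /\ bin_value b p.1 <> bin_value b p.2]).
have n0 : 0 < (size s).+1%:R :> R by rewrite ltr0n.
have changes : pr P (F `&` J) <= k%:R / (size s).+1%:R * pr P F.
  have -> : k%:R / (size s).+1%:R * pr P F =
      \sum_(b <- enum 'I_k) (size s).+1%:R^-1 * pr P F.
    rewrite big_const_seq count_predT iter_addr_0 size_enum_ord -[RHS]mulr_natl.
    by rewrite mulrA.
  apply: (@le_trans _ _ (\sum_(b <- enum 'I_k) pr P (C b))).
    apply: pr_bigcup_seq => //; first exact: measurableI.
    move=> w [Fw Jw]; apply: contrapT => noC; apply: Jw; apply/ffunP => b.
    rewrite !ffunE; apply: contrapT => Cb; apply: noC; exists b => //=.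
    by rewrite mem_enum.
  apply: ler_sum => b _; rewrite ler_pdivlMl//.
  exact: pr_removal_changes_bin.
have keeps : pr P (F `&` ~` J) <= pr P [set w | A (state_of (hashes s w))].
  apply: le_pr.
  - by apply: measurableI => //; exact: measurableC.
  - exact: (@dhashes s [set v | A (state_of v)]).
  - by move=> w [Fw /contrapT Jw]; rewrite /= -Jw.
rewrite mulrBl mul1r lerBlDr {1}(pr_splitC P mF mJ) addrC.
exact: lerD.
Qed.

(* The exponent is the number of items including [x].  The factor due to [x] is
   the probability 1/k of hitting bin [b] if k > 1; if k = 1, the bin is almost
   surely nonempty, so that raising it needs a value > 1, of probability 1/2. *)
Lemma pr_low_bin_raised x s b g : uniq (x :: s) -> (0 < size s)%N ->
  pr P [set w | (bin_value b (hashes s w) <= g)%N /\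
    (H x w).1 = b /\ (bin_value b (hashes s w) < (H x w).2)%N] <=
  (1 - k%:R^-1 * 2^-1 ^+ g) ^+ (size s).+1.
Proof.
move=> uxs s0; set p : R := 1 - _.
have k0 : (0 < k)%N by case: (k) b => // -[].
have kR : 0 < k%:R :> R by rewrite ltr0n.
have half_g : 0 < (2^-1 : R) ^+ g <= 1.
  by rewrite exprn_gt0 ?invr_gt0//= exprn_ile1 ?invr_ge0// invf_le1 ?ler1n.
have p_ge : 1 - k%:R^-1 <= p.
  by rewrite /p lerD2l lerN2 ler_piMr//; case/andP: half_g.
have kV1 : k%:R^-1 <= 1 :> R by rewrite invf_le1 ?ler1n.
have p0 : 0 <= p by lra.
set Bad := [set w | _].
have mBad : measurable Bad.
  exact: (@dHhashes x s [set q | (bin_value b q.2 <= g)%N /\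
    q.1.1 = b /\ (bin_value b q.2 < q.1.2)%N]).
pose low C := [set w | (bin_value b (hashes s w) <= g)%N /\ C (H x w)].
have mlow C : measurable (low C).
  exact: (@dHhashes x s [set q | (bin_value b q.2 <= g)%N /\ C q.1]).
(* For k > 1 the extra factor comes from 1/k <= 1/2 <= 1 - 1/k <= [p]. *)
have [k1|k1] := leqP k 1; last first.
  apply: (@le_trans _ _ (pr P (low [set y | y.1 = b]))).
    by apply: le_pr => // w [lo [xb _]].
  rewrite pr_bin_value_le// -/p exprSr ler_wpM2l ?exprn_ge0//.
  rewrite (pr_bin hH); apply: le_trans p_ge.
  have : k%:R^-1 <= 2^-1 :> R by rewrite lef_pV2 ?posrE// ler_nat.
  by lra.
have {}k1 : k = 1%N by apply/eqP; rewrite eqn_leq k1.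
have [z zs] : exists z, z \in s by case: (s) s0 => // z ? _; exists z; rewrite mem_head.
pose N := [set w | (H z w).2 = 0%N].
have mN : measurable N by exact: dH [set y | y.2 = 0%N].
have b_unique c : c = b.
  apply: val_inj; move: (ltn_ord c) (ltn_ord b).
  by rewrite {2 4}k1 /= !ltnS !leqn0 => /eqP -> /eqP ->.
(* With a single bin, value 0 would force the item [z] to level 0, a null event; otherwise raising
   the bin needs a level above 1. *)
have BadS : Bad `<=` low [set y | (1 < y.2)%N] `|` N.
  move=> w [lo [_ lt_x]]; have [s_0|s_gt0] := posnP (bin_value b (hashes s w)).
    right; apply/eqP; rewrite -leqn0 -s_0 -(b_unique (H z w).1).
    by apply: bin_value_ge; exact: map_f.
  by left; split=> //=; exact: leq_ltn_trans lt_x.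
have Bad_le : pr P Bad <= pr P (low [set y | (1 < y.2)%N]).
  rewrite (pr_splitC P mBad mN) -[leRHS]add0r lerD//.
    rewrite -(pr_level_0 hH z); apply: le_pr => //; exact: measurableI.
  apply: le_pr => //; first by apply: measurableI => //; exact: measurableC.
  by move=> w [/BadS[]].
apply: (le_trans Bad_le); rewrite pr_bin_value_le// -/p (pr_level_gt hH x 1).
have pE : p = 1 - 2^-1 ^+ g by rewrite /p k1 invr1 mul1r.
(* For g = 0, [p] is 0 and both sides vanish since [s] is nonempty; for g > 0, [p] is at least 1/2,
   the factor of [x]. *)
rewrite [leRHS]exprSr; case: (g) pE => [|g'] pE.
  by rewrite pE expr0 subrr expr0n eqn0Ngt s0 !mul0r.
rewrite ler_wpM2l ?exprn_ge0// pE expr1 exprS.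
have : 2^-1 ^+ g' <= 1 :> R by rewrite exprn_ile1 ?invr_ge0// invf_le1 ?ler1n.
by lra.
Qed.

(** Split by the value l of bin [b]. If l > [g], then [x] hits without raising with probability (1 -
    2^-l)/k >= c/k. Otherwise every hit is counted, and those that raise the bin form the error
    term. *)
Lemma pr_bin_unaffected x s b (g : nat) (c : R) (A : set {ffun 'I_k -> nat}) :
  uniq (x :: s) -> (0 < size s)%N -> 0 <= c <= 1 ->
  (forall l, (g < l)%N -> c <= 1 - 2^-1 ^+ l) ->
  c / k%:R * pr P [set w | A (state_of (hashes s w))] <=
  pr P [set w | A (state_of (hashes s w)) /\
    (H x w).1 = b /\ ((H x w).2 <= bin_value b (hashes s w))%N] +
  c * (1 - k%:R^-1 * 2^-1 ^+ g) ^+ (size s).+1.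
Proof.
move=> uxs s0 /andP[c0 c1] c_le.
set F := [set w | A _].
pose Q := [set w | (H x w).1 = b /\ ((H x w).2 <= bin_value b (hashes s w))%N].
pose B := [set w | (H x w).1 = b].
pose L := [set w | (bin_value b (hashes s w) <= g)%N].
have mF : measurable F by exact: (@dhashes s [set v | A (state_of v)]).
have mL : measurable L by exact: (@dhashes s [set v | (bin_value b v <= g)%N]).
have mB : measurable B by exact: (@dH x [set y | y.1 = b]).
have mQ : measurable Q.
  exact: (@dHhashes x s [set q | q.1.1 = b /\ (q.1.2 <= bin_value b q.2)%N]).
have dS := discrete_rv_hashes hH s.
have k0 : 0 <= k%:R^-1 :> R by rewrite invr_ge0.
have high : c / k%:R * pr P (F `&` ~` L) <= pr P (F `&` ~` L `&` Q).
  pose E : set (seq ('I_k * nat)) :=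
    [set v | A (state_of v) /\ ~ (bin_value b v <= g)%N].
  have -> : F `&` ~` L = hashes s @^-1` E by [].
  rewrite -[X in _ * pr P X <= _]setIT.
  apply: (@le_pr_countable _ _ _ _ _ (hashes s) (hashes s) setT Q E) => //.
    exact: mulr_ge0.
  move=> v [_ /negP].
  rewrite -ltnNge setIT => gv.
  (* On an atom the bin value is a constant, so the condition bears on [H x] alone. *)
  have -> : hashes s @^-1` [set v] `&` Q = hashes s @^-1` [set v] `&`
      H x @^-1` [set y | y.1 = b /\ [set l | (l <= bin_value b v)%N] y.2].
    by apply/seteqP; split=> w [/= Hv]; rewrite /Q /= Hv.
  rewrite pr_hashes_head// (pr_bin_level hH) (pr_level_le hH) mulrC.
  by rewrite ler_wpM2l ?pr_ge0// mulrC ler_wpM2l// c_le.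
(* Bounding with 1/k and multiplying by [c] only afterwards leaves the factor [c] on the error term,
   where it later cancels e^eps. *)
have low : k%:R^-1 * pr P (F `&` L) <= pr P (F `&` L `&` Q) +
    (1 - k%:R^-1 * 2^-1 ^+ g) ^+ (size s).+1.
  have mFL : measurable (F `&` L) by exact: measurableI.
  apply: (@le_trans _ _ (pr P (F `&` L `&` B))).
    pose E : set (seq ('I_k * nat)) :=
      [set v | A (state_of v) /\ (bin_value b v <= g)%N].
    have -> : F `&` L = hashes s @^-1` E by [].
    rewrite -[X in _ * pr P X]setIT.
    apply: (@le_pr_countable _ _ _ _ _ (hashes s) (hashes s) setT B E) => // v _.
    rewrite setIT (pr_hashes_head hH v [set y | y.1 = b] uxs) mulrC.
    by rewrite (pr_bin hH).
  have mFLB : measurable (F `&` L `&` B) by exact: measurableI.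
  rewrite (pr_splitC P mFLB mQ) lerD//.
    apply: le_pr; [exact: measurableI|exact: measurableI|].
    by move=> w [[FLw _] Qw].
  apply: le_trans (pr_low_bin_raised b g uxs s0); apply: le_pr.
  - by apply: measurableI => //; exact: measurableC.
  - exact: (@dHhashes x s [set q | (bin_value b q.2 <= g)%N /\
      q.1.1 = b /\ (bin_value b q.2 < q.1.2)%N]).
  move=> w [[[_ Lw] Bw] nQ]; split=> //; split=> //.
  by rewrite ltnNge; apply/negP => Gw; exact: nQ.
have mFQ : measurable (F `&` Q) by exact: measurableI.
rewrite (pr_splitC P mF mL) -/(F `&` Q) (pr_splitC P mFQ mL).
rewrite !(setIAC F Q) mulrDr addrAC lerD// -mulrA.
apply: (le_trans (ler_wpM2l c0 low)).
by rewrite mulrDr lerD2r ler_piMl ?pr_ge0.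
Qed.

(** Landing in [b] without raising it leaves the state unchanged, and these events are disjoint over
    [b]; each bin contributes a share c/k and one error term. *)
Lemma pr_le_insert x s (g : nat) (c : R) (A : set {ffun 'I_k -> nat}) :
  (0 < k)%N -> uniq (x :: s) -> (0 < size s)%N -> 0 <= c <= 1 ->
  (forall l, (g < l)%N -> c <= 1 - 2^-1 ^+ l) ->
  c * pr P [set w | A (state_of (hashes s w))] <=
  pr P [set w | A (state_of (hashes (x :: s) w))] +
  c * (k%:R * (1 - k%:R^-1 * 2^-1 ^+ g) ^+ (size s).+1).
Proof.
move=> k0 uxs s0 c01 c_le.
set p : R := (_ ^+ _); set F := [set w | A (state_of (hashes s w))].
pose FQ b := [set w | A (state_of (hashes s w)) /\
  (H x w).1 = b /\ ((H x w).2 <= bin_value b (hashes s w))%N].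
have sum_const (a : R) : \sum_(b <- enum 'I_k) a = k%:R * a.
  by rewrite big_const_seq count_predT iter_addr_0 size_enum_ord mulr_natl.
have -> : c * pr P F = \sum_(b <- enum 'I_k) c / k%:R * pr P F.
  by rewrite sum_const mulrA mulrCA mulfV ?mulr1// pnatr_eq0 -lt0n.
apply: (@le_trans _ _ (\sum_(b <- enum 'I_k) (pr P (FQ b) + c * p))).
  by apply: ler_sum => b _; exact: pr_bin_unaffected.
rewrite big_split/= sum_const [c * (_ * _)]mulrCA lerD2r.
apply: pr_disjoint_seq.
- exact: enum_uniq.
- move=> b; exact: (@dHhashes x s [set q | A (state_of q.2) /\
    q.1.1 = b /\ (q.1.2 <= bin_value b q.2)%N]).
- exact: (@dhashes (x :: s) [set v | A (state_of v)]).
- move=> b _ w [Aw [xb xw]] /=; suff -> : state_of (H x w :: hashes s w) =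
    state_of (hashes s w) by [].
  by apply/eqP; rewrite state_of_cons_id xb.
- by move=> b b' w _ _ [_ [<- _]] [_ [<- _]].
Qed.

End Privacy.

(** * The threshold level and the final estimate *)

Lemma half_power_threshold (R : realType) (y : R) : 0 < y < 1 ->
  exists2 g : nat, y < 2^-1 ^+ g & forall l, (g < l)%N -> 2^-1 ^+ l <= y.
Proof.
move=> /andP[y0 y1].
have ex : exists g : nat, 2^-1 ^+ g <= y.
  exists (Num.bound y^-1); have /ltW := @upper_nthrootP R y^-1 _ (leqnn _).
  set g := Num.bound _ => yg.
  by rewrite exprVn -[leRHS]invrK lef_pV2// posrE ?invr_gt0// exprn_gt0.
(* The least exponent with 2^-g <= y is positive because y < 1; its predecessor is the threshold. *)
case: (ex_minnP ex) => -[|g] gy gmin.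
  by move: gy; rewrite expr0 leNgt y1.
exists g; first by rewrite ltNge; apply/negP => /gmin; rewrite ltnn.
move=> l gl; apply: le_trans gy.
by rewrite ler_wiXn2l// ?invr_ge0// invf_le1 ?ler1n.
Qed.

Theorem theorem9 (R : realType) (d : measure_display) (T : measurableType d)
    (P : probability T R) (U : choiceType) (k : nat) (hk : (0 < k)%N)
    (H : U -> T -> 'I_k * nat) (hH : uniform_hash P H)
    (eps : R) (heps : 0 < eps) (n : nat) :
  let pi0 := 1 - expR (- eps) in
  let n0 := k%:R / (1 - expR (- eps)) in
  n0 <= n%:R ->
  exists delta : R,
    [/\ 0 <= delta, delta <= k%:R * expR (- (pi0 * n%:R / k%:R)) &
        sketch_dp P (hll_sketch H) n eps delta].
Proof.
(* The witness is the claimed upper bound itself. *)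
move=> pi0 n0 n0n; set delta := k%:R * _; exists delta.
have delta0 : 0 <= delta by rewrite mulr_ge0 ?expR_ge0.
split=> // D Dn i iD A.
have c0 : 0 < expR (- eps) by exact: expR_gt0.
have c1 : expR (- eps) < 1 by rewrite expR_lt1 oppr_lt0.
have pi01 : 0 < pi0 < 1 by rewrite /pi0; lra.
have k0 : 0 < k%:R :> R by rewrite ltr0n.
have kn : k%:R <= pi0 * n%:R by rewrite mulrC -ler_pdivrMr//; case/andP: pi01.
set s := enum_fset (D `\ i)%fset.
have uis : uniq (i :: s) by rewrite /= fset_uniq andbT !inE eqxx.
(* The enumeration of [D] need not start with [i], but bin values ignore the order of insertion. *)
have Dis : perm_eq D (i :: s).
  apply: uniq_perm => // x; rewrite in_cons !inE.
  by case: eqP => // ->; rewrite iD.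
have sn : (size s).+1 = n by rewrite -Dn (perm_size Dis).
(* Since n >= k/pi0 > 1, some item remains after the removal of [i]. *)
have s0 : (0 < size s)%N.
  rewrite -ltnS sn -(ltr_nat R) mulr1n; apply: contraTT kn.
  rewrite -leNgt -ltNge => n1; apply: (@lt_le_trans _ _ 1); last by rewrite ler1n.
  case/andP: pi01 => pi0_gt0 pi0_lt1.
  by apply: le_lt_trans pi0_lt1; rewrite ler_piMr// ltW.
have SE : hll_sketch H D @^-1` A = [set w | A (state_of (hashes H (i :: s) w))].
  apply/seteqP; suff E w : hll_sketch H D w = state_of (hashes H (i :: s) w).
    by split=> w /=; rewrite E.
  rewrite /hll_sketch hll_state_map; apply/ffunP => b; rewrite !ffunE.
  exact/bin_value_perm/perm_map.
have SE' : hll_sketch H (D `\ i)%fset @^-1` A =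
    [set w | A (state_of (hashes H s w))].
  by apply/seteqP; split=> w; rewrite /= /hll_sketch hll_state_map.
have mS t : measurable [set w | A (state_of (hashes H t w))].
  exact: (discrete_rv_hashes hH t [set v | A (state_of v)]).
rewrite SE SE' !prE// -!EFinM -!EFinD !lee_fin.
have eV : expR eps * expR (- eps) = 1 by rewrite -expRD subrr expR0.
have le_eps (a b : R) : expR (- eps) * a <= b -> a <= expR eps * b.
  move=> /(ler_wpM2l (expR_ge0 eps)); by rewrite mulrA eV mul1r.
split.
  apply: (@le_trans _ _ (expR eps * pr P [set w | A (state_of (hashes H s w))])).
    (* From n >= k/pi0 follows 1 - k/n >= 1 - pi0 = e^-eps. *)
    apply: le_eps; apply: le_trans (pr_insert_le hH A uis).
    rewrite ler_wpM2r ?pr_ge0// sn lerBrDl -lerBrDr.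
    rewrite ler_pdivrMr// ltr0n -sn//.
  by rewrite lerDl.
(* The threshold at pi0: above [g], 1 - 2^-l >= e^-eps, while 2^-g > pi0 makes the error term
   small. *)
have [g g_lt g_le] := half_power_threshold pi01.
have c_le l : (g < l)%N -> expR (- eps) <= 1 - 2^-1 ^+ l.
  by move=> /g_le; rewrite /pi0; lra.
have c01 : 0 <= expR (- eps) <= 1 by rewrite !ltW.
have := pr_le_insert hH A hk uis s0 c01 c_le; rewrite sn -lerBlDr -mulrBr.
move=> /le_eps; rewrite lerBlDr => /le_trans; apply; rewrite lerD2l ler_wpM2l//.
(* It remains to raise 1 - 2^-g/k <= 1 - pi0/k <= exp(-pi0/k) to the power n. *)
have -> : - (pi0 * n%:R / k%:R) = n%:R * - (pi0 / k%:R) by ring.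
rewrite expRM_natl lerXn2r ?nnegrE ?expR_ge0//.
  rewrite subr_ge0 mulr_ile1 ?invr_ge0 ?exprn_ge0// ?exprn_ile1 ?invr_ge0//.
  - by rewrite invf_le1 ?ler1n.
  - by rewrite invf_le1 ?ler1n.
apply: le_trans (expR_ge1Dx _); rewrite lerD2l lerN2 mulrC ler_wpM2l ?invr_ge0//.
exact: ltW.
Qed.
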